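(* Let $X$ be a complex manifold of dimension $3$, let $x\in X$, and let $A_3=\bigoplus_m (E_{3,m}T_X^* )_x$ be the algebra of invariant jet differentials of order $3$ at $x$, viewed in local coordinates as the algebra of $G_3'$-invariants in the polynomial ring $\mathbb{C}[f_i',f_i'',f_i''' : 1\le i\le 3]$. Then $$A_3=\mathbb{C}\big[f_l',\,w_{ij},\,w_{ij}^k,\,W \;:\; 1\le l\le 3,\ 1\le i<j\le 3,\ 1\le k\le 3\big],$$ the subalgebra generated by the listed elements, where $$W=\begin{vmatrix} f_1' & f_2' & f_3'\\ f_1''&f_2''&f_3''\\ f_1'''&f_2'''&f_3'''\end{vmatrix},\qquad w_{ij}=f_i'f_j''-f_i''f_j',\qquad w_{ij}^k=f_k'(f_i'f_j'''-f_i'''f_j')-3f_k''(f_i'f_j''-f_i''f_j').$$ Moreover, the field $\mathbb{C}(f_l',w_{ij},w_{ij}^k,W)$ generated by these elements has transcendence degree $7$ over $\mathbb{C}$.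
   Context: For a complex manifold $X$ of dimension $n$, $E_{k,m}T_X^*$ is the bundle of invariant jet differentials of order $k$ and degree $m$ (Demailly–Semple). Its fibre at $x$ consists of the complex polynomials $Q(f',f'',\dots,f^{(k)})$ in the derivatives at $0$ of germs $f=(f_1,\dots,f_n):(\mathbb{C},0)\to (X,x)$ (in local coordinates; the $f_i^{(j)}$, $1\le i\le n$, $1\le j\le k$, are treated as independent variables) such that $Q((f\circ\phi)',\dots,(f\circ\phi)^{(k)})=\phi'(0)^m Q(f',\dots,f^{(k)})$ for every $k$-jet of germ of biholomorphism $\phi$ of $(\mathbb{C},0)$. Let $G_k'$ be the group of $k$-jets of reparametrizations $\phi(t)=t+b_2t^2+\dots+b_kt^k$ tangent to the identity. Then $\bigoplus_m (E_{k,m}T_X^* )_x=\mathbb{C}[f',f'',\dots,f^{(k)}]^{G_k'}$. For $k=3$ the action is, for each $i$: $f_i'\mapsto f_i'$, $f_i''\mapsto f_i''+2b_2f_i'$, $f_i'''\mapsto f_i'''+6b_2f_i''+6b_3f_i'$, with $b_2,b_3\in\mathbb{C}$ arbitrary. *)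

(* Defs.v *)
From HB Require Import structures.
From mathcomp Require Import all_boot all_order all_algebra.
From mathcomp Require Import complex.
From mathcomp Require Import reals ring.
From mathcomp Require Export mpoly.

Set Implicit Arguments.
Unset Strict Implicit.
Unset Printing Implicit Defensive.

Import GRing.Theory.
Local Open Scope ring_scope.

Inductive subalg_gen (K : comNzRingType) (A : algType K) (G : A -> Prop) :
    A -> Prop :=
| SubalgScalar (c : K) : subalg_gen G c%:A
| SubalgGen x : G x -> subalg_gen G x
| SubalgAdd x y : subalg_gen G x -> subalg_gen G y -> subalg_gen G (x + y)
| SubalgMul x y : subalg_gen G x -> subalg_gen G y -> subalg_gen G (x * y).

(* Opposites come from [iota (-1)]. *)
Inductive subfield_gen (K L : fieldType) (iota : {rmorphism K -> L})
    (G : L -> Prop) : L -> Prop :=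
| SubfieldScalar (c : K) : subfield_gen iota G (iota c)
| SubfieldGen x : G x -> subfield_gen iota G x
| SubfieldAdd x y : subfield_gen iota G x -> subfield_gen iota G y ->
    subfield_gen iota G (x + y)
| SubfieldMul x y : subfield_gen iota G x -> subfield_gen iota G y ->
    subfield_gen iota G (x * y)
| SubfieldInv x : subfield_gen iota G x -> subfield_gen iota G x^-1.

Definition alg_independent (K L : fieldType) (iota : {rmorphism K -> L})
    (d : nat) (s : d.-tuple L) : Prop :=
  forall P : {mpoly K[d]}, mmap iota (tnth s) P = 0 -> P = 0.

Definition algebraic_over (L : fieldType) (F : L -> Prop) (y : L) : Prop :=
  exists p : {poly L}, [/\ p != 0, forall i, F p`_i & root p y].

(* The subfield F of L, containing the image of K, has a transcendence basis
   of cardinality d over K. *)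
Definition has_trdeg (K L : fieldType) (iota : {rmorphism K -> L})
    (F : L -> Prop) (d : nat) : Prop :=
  exists s : d.-tuple L,
    [/\ forall y, y \in s -> F y,
        alg_independent iota s
      & forall y, F y ->
          algebraic_over (subfield_gen iota (fun z => z \in s)) y].

(* The ring of polynomials in the f_i^(j), 1 <= i <= n, 1 <= j <= k. *)
Notation jet_ring K k n := {mpoly K[(k * n)%N]}.

Section Jets.
Variables (K : numFieldType) (k n : nat).

(* [dvar j i] is the variable f_i^(j+1): indices start at 0. *)
Definition dvar (j : 'I_k) (i : 'I_n) : jet_ring K k n := 'X_(mxvec_index j i).

(* Taylor polynomial at 0 of f_i, in a chart centred at x. *)
Definition generic_jet (i : 'I_n) : {poly jet_ring K k n} :=
  \sum_(l < k) (((l.+1)`!%:R^-1 : K) *: dvar l i)%:P * 'X^(l.+1).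

(* (f_i o phi)^(j+1) at 0. *)
Definition reparam_dvar (phi : {poly K}) (j : 'I_k) (i : 'I_n) :
    jet_ring K k n :=
  ((generic_jet i \Po map_poly (@mpolyC (k * n) K) phi)^`(j.+1)).[0].

(* Q |-> Q((f o phi)', ..., (f o phi)^(k)). *)
Definition reparam (phi : {poly K}) (Q : jet_ring K k n) : jet_ring K k n :=
  Q \mPo [tuple mxvec (\matrix_(j, i) reparam_dvar phi j i) 0 v | v < (k * n)%N].

(* k-jets of germs of biholomorphisms of (C, 0), as Taylor polynomials. *)
Definition biholo_jet (phi : {poly K}) : Prop :=
  [/\ (size phi <= k.+1)%N, phi.[0] = 0 & phi^`().[0] != 0].

(* G_k'. *)
Definition unipotent_jet (phi : {poly K}) : Prop :=
  [/\ (size phi <= k.+1)%N, phi.[0] = 0 & phi^`().[0] = 1].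

(* The fibre of E_{k,m} T_X^* at x. *)
Definition invariant_jet_diff (m : nat) (Q : jet_ring K k n) : Prop :=
  forall phi, biholo_jet phi -> reparam phi Q = (phi^`().[0] ^+ m) *: Q.

(* The sum over m of the fibres, inside the polynomial ring; it is direct
   because phi = a t forces elements of degree m to be weighted homogeneous of
   weight m. *)
Definition jet_diff_algebra (Q : jet_ring K k n) : Prop :=
  exists (d : nat) (q : nat -> jet_ring K k n),
    (forall m, invariant_jet_diff m (q m)) /\ Q = \sum_(m < d) q m.

(* C[f', ..., f^(k)]^(G_k'). *)
Definition unipotent_invariant (Q : jet_ring K k n) : Prop :=
  forall phi, unipotent_jet phi -> reparam phi Q = Q.

Definition jet_frac_embed : {rmorphism K -> {fraction jet_ring K k n}} :=
  (@FracField.tofrac (jet_ring K k n) \o @mpolyC (k * n) K).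

End Jets.

Lemma cubic_comp (A : comNzRingType) (c1 c2 c3 B2 B3 : A) :
  exists r, (c1%:P * 'X + c2%:P * 'X^2 + c3%:P * 'X^3)
      \Po ('X + B2%:P * 'X^2 + B3%:P * 'X^3)
    = c1%:P * 'X + (c1 * B2 + c2)%:P * 'X^2
      + (c1 * B3 + 2%:R * (c2 * B2) + c3)%:P * 'X^3 + r * 'X^4.
Proof.
exists ((c2 * B2 ^+ 2 + 2%:R * (c2 * B3) + 3%:R * (c3 * B2))%:P
  + (2%:R * (c2 * B2 * B3) + 3%:R * (c3 * B3) + 3%:R * (c3 * B2 ^+ 2))%:P * 'X
  + (c2 * B3 ^+ 2 + 6%:R * (c3 * B2 * B3) + c3 * B2 ^+ 3)%:P * 'X^2
  + (3%:R * (c3 * B3 ^+ 2) + 3%:R * (c3 * B2 ^+ 2 * B3))%:P * 'X^3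
  + (3%:R * (c3 * B2 * B3 ^+ 2))%:P * 'X^4
  + (c3 * B3 ^+ 3)%:P * 'X^5).
rewrite !(comp_polyD, comp_Xn_poly, comp_polyC, comp_polyX, comp_polyM).
rewrite !(polyCD, polyCM, rmorphXn, rmorph_nat) /=.
ring.
Qed.

Section Order3Dim3.
Variable K : numFieldType.

Local Notation ring := (jet_ring K 3 3).

Definition d1 (i : 'I_3) : ring := dvar K (0 : 'I_3) i.
Definition d2 (i : 'I_3) : ring := dvar K (1 : 'I_3) i.
Definition d3 (i : 'I_3) : ring := dvar K (2%:R : 'I_3) i.

Definition w2 (i j : 'I_3) : ring := d1 i * d2 j - d2 i * d1 j.

Definition w3 (k i j : 'I_3) : ring :=
  d1 k * (d1 i * d3 j - d3 i * d1 j) - 3%:R * d2 k * (d1 i * d2 j - d2 i * d1 j).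

Definition wronskian : ring := \det (\matrix_(j, i) dvar K (j : 'I_3) (i : 'I_3)).

Inductive jet_generator : ring -> Prop :=
| GenD1 l : jet_generator (d1 l)
| GenW2 (i j : 'I_3) : (i < j)%N -> jet_generator (w2 i j)
| GenW3 (k i j : 'I_3) : (i < j)%N -> jet_generator (w3 k i j)
| GenWronskian : jet_generator wronskian.

Definition jet_generator_frac (y : {fraction ring}) : Prop :=
  exists2 g, jet_generator g & y = FracField.tofrac g.

Lemma reparam_dvar3 (b2 b3 : K) (i : 'I_3) :
  let phi : {poly K} := 'X + b2 *: 'X^2 + b3 *: 'X^3 in
  [/\ reparam_dvar phi 0 i = d1 i,
      reparam_dvar phi 1 i = d2 i + (2%:R * b2) *: d1 i
    & reparam_dvar phi 2%:R i
      = d3 i + (6%:R * b2) *: d2 i + (6%:R * b3) *: d1 i].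
Proof.
move=> phi.
pose B2 : ring := b2%:MP; pose B3 : ring := b3%:MP.
pose c1 : ring := d1 i.
pose c2 : ring := (2%:R^-1 : K) *: d2 i.
pose c3 : ring := (6%:R^-1 : K) *: d3 i.
pose P := c1%:P * 'X + (c1 * B2 + c2)%:P * 'X^2
  + (c1 * B3 + 2%:R * (c2 * B2) + c3)%:P * 'X^3.
have [r EP] : exists r, generic_jet K 3 i \Po map_poly (@mpolyC (3 * 3) K) phi
    = P + r * 'X^4.
  have -> : map_poly (@mpolyC (3 * 3) K) phi
      = 'X + B2%:P * 'X^2 + B3%:P * 'X^3.
    by rewrite /phi !rmorphD /= !map_polyZ /= !rmorphXn /= !map_polyX -!mul_polyC.
  have -> : generic_jet K 3 i = c1%:P * 'X + c2%:P * 'X^2 + c3%:P * 'X^3.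
    have sum3 (V : nmodType) (F : 'I_3 -> V) :
        \sum_(l < 3) F l = F 0 + F 1 + F 2%:R.
      rewrite !big_ord_recl big_ord0 addr0 addrA.
      by congr (_ + F _ + F _); apply: val_inj.
    rewrite /generic_jet sum3.
    rewrite -[(nat_of_ord 0).+1]/1%N.
    rewrite -[(nat_of_ord 1).+1]/2%N.
    rewrite -[(nat_of_ord 2%:R).+1]/3%N.
    have -> : 3`! = 6%N by []. have -> : 2`! = 2%N by []. have -> : 1`! = 1%N by [].
    rewrite (invr1 K) scale1r.
    reflexivity.
  exact: cubic_comp.
have E (m : nat) : (P + r * 'X^4)^`(m).[0] = (P + r * 'X^4)`_m *+ m`!.
  by rewrite horner_coef0 coef_derivn addn0 ffactnn.
have nz (m : nat) : (m.+1%:R : K) != 0 by rewrite Num.Theory.pnatr_eq0.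
rewrite /reparam_dvar EP !E.
rewrite !(coefD, coefCM, coefXn, coefX, coefMXn) /= !(mulr0, mulr1, addr0, add0r).
have EB (b : K) (p : ring) : p * b%:MP = b *: p by rewrite mulrC mul_mpolyC.
rewrite /B2 /B3 !EB /c2 /c3 -!scaler_nat !scalerDr !scalerA.
have -> : (((1 %% 3 + 1 %% 3) %% 3).+1)`! = 6%N by [].
have -> : ((1 %% 3).+1)`! = 2%N by [].
have -> : 1`! = 1%N by [].
rewrite !mulr_algl !scalerA scale1r -/c1.
split=> //; first by rewrite mulfV ?nz // scale1r addrC.
rewrite mulfV ?nz // scale1r addrC [_ *: c1 + _]addrC addrA.
congr (_ + _ *: _ + _); first by field.
Qed.

End Order3Dim3.

(* Main.v *)
Require Import Defs.
From HB Require Import structures.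
From Stdlib Require Import Classical.
From mathcomp Require Import all_boot all_order all_algebra.
From mathcomp Require Import complex reals ring zify.
Set Implicit Arguments.
Unset Strict Implicit.
Unset Printing Implicit Defensive.
Import Order.TTheory GRing.Theory Num.Theory.
Local Open Scope ring_scope.

(** Write x, y, z for the rows f', f'', f''' of the 3 x 3 matrix of jet
    coordinates.  The group G_3' acts by the row operations y -> y + s x,
    z -> z + 3 s y (up to a multiple of x) and z -> z + t x.  They commute with
    the linear substitutions of the columns f_1, f_2, f_3, so the algebra A of
    invariants and its subalgebra B generated by the listed elements are both
    stable under GL_3.  By complete reducibility, A = B as soon as every highest
    weight vector of A lies in B.

    Complete reducibility is obtained from an explicit unitary structure.  The
    operators E_ab = sum_r X_rb d/dX_ra ([polar a b]) generate the action of
    gl_3, and E_ba is the adjoint of E_ab for the Fischer product, in which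
    monomials are orthogonal with squared norm m! ([fischer_polar]).  Project an
    invariant of degree at most N orthogonally to B in degree at most N
    ([orthogonal_projection]).  The remainders form a space that is stable under
    the raising operators, because B is stable under the lowering ones.  Raising
    decreases a weight, so a nonzero remainder of least weight would be a
    highest weight vector; it would then lie in B and be orthogonal to itself
    ([orthogonal_unipotent_eq0]).

    A highest weight vector p of A is unchanged by the row operations above and
    by the unipotent column operations.  With coefficients in a field of
    fractions these operations bring the generic matrix to the normal form with
    rows (a, 0, 0), (0, b/a, 0), (0, c/a^2, d/b), where a = f_1', b = w_12,
    c = w_12^1 and d = W ([jet_eval_normal_form]); columns are numbered from 1
    in these formulas and from 0 in the declarations below.  Hence (a^2 b)^N p is a
    polynomial in a, b, c, d for some N.  The factors a and b cancel one at a
    time: b, c, d stay algebraically independent on the locus a = 0, and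
    a, c, d on the locus b = 0, so a polynomial in a, b, c, d that is divisible
    by a, or by b, in the jet ring is already so as a polynomial in a, b, c, d
    ([hw_eval_divide]).

    The listed elements are jet differentials of a definite weight, whence B is
    contained in the sum of the fibres of the E_{3,m}, which is contained in A.
    For the transcendence degree, row operations alone reach the slice on which
    f_1'' = f_1''' = 0; there f_l', w_12, w_13, w_12^1, w_13^1 are the seven
    coordinates up to powers of f_1', and every generator is a rational function
    of them. *)

(** * Polynomial rings and their fraction fields *)

Lemma mpoly_ring_ind (n : nat) (R : comNzRingType) (P : {mpoly R[n]} -> Prop) :
  (forall c, P c%:MP) -> (forall i, P 'X_i) ->
  (forall p q, P p -> P q -> P (p + q)) ->
  (forall p q, P p -> P q -> P (p * q)) -> forall p, P p.
Proof.
move=> PC PX PD PM p; rewrite (mpolyE p).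
elim/big_rec: _ => [|m q _ Pq]; first exact: (PC 0).
apply: PD => //; rewrite -mul_mpolyC; apply: (PM) => //.
rewrite mpolyXE_id.
apply: (big_ind P) => [|r t Pr Pt|i _]; [exact: (PC 1) | exact: PM |].
elim: (m i : nat) => [|k IH]; first exact: (PC 1).
by rewrite exprS; apply: (PM).
Qed.

Lemma mmap_unique (n : nat) (R S : comNzRingType) (f g : {rmorphism {mpoly R[n]} -> S}) :
  (forall c, f c%:MP = g c%:MP) -> (forall i, f 'X_i = g 'X_i) -> f =1 g.
Proof.
move=> fgC fgX; apply: mpoly_ring_ind => // p q Ep Eq.
  by rewrite !rmorphD Ep Eq.
by rewrite !rmorphM Ep Eq.
Qed.

Lemma eq_mmap (n : nat) (R S : comNzRingType) (h : {rmorphism R -> S})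
    (M N : 'I_n -> S) : M =1 N -> mmap h M =1 mmap h N.
Proof.
move=> MN; apply: mmap_unique => [c|i] /=; first by rewrite !mmapC.
by rewrite !mmapX !mmap1U.
Qed.

Lemma mmap_comp (n m : nat) (R S : comNzRingType) (h : {rmorphism R -> S})
    (f : {rmorphism {mpoly R[m]} -> S}) (g : 'I_n -> {mpoly R[m]}) F :
  (forall c, f c%:MP = h c) ->
  f (mmap (@mpolyC m R) g F) = mmap h (fun i => f (g i)) F.
Proof.
move=> fC; pose fg := f \o mmap (@mpolyC m R) g.
suff: fg =1 mmap h (fun i => f (g i)) by apply.
apply: mmap_unique => [c|i] /=; first by rewrite !mmapC fC.
by rewrite !mmapX !mmap1U.
Qed.

(** The remainder of F modulo a variable is its value where that variable is 0. *)
Lemma mpoly_split_var (K : comNzRingType) (n : nat) (i : 'I_n) (F : {mpoly K[n]}) :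
  exists F', F = 'X_i * F'
    + mmap (@mpolyC n K) (fun j => if j == i then 0 else 'X_j) F.
Proof.
elim/mpoly_ring_ind: F => [c|j|p q [p' Ep] [q' Eq]|p q [p' Ep] [q' Eq]].
- by exists 0; rewrite mmapC mulr0 add0r.
- rewrite mmapX mmap1U; case: (j =P i) => [->|_]; last by exists 0; rewrite mulr0 add0r.
  by exists 1; rewrite mulr1 addr0.
- by exists (p' + q'); rewrite rmorphD /= mulrDr addrACA -Ep -Eq.
- rewrite rmorphM /=; set p0 := mmap _ _ p in Ep *; set q0 := mmap _ _ q in Eq *.
  by exists (p' * q + p0 * q'); rewrite [in LHS]Ep [in LHS]Eq [in RHS]Eq; ring.
Qed.

Lemma tofracK (R : idomainType) : injective (@FracField.tofrac R).
Proof. by move=> x y /eqP; rewrite tofrac_eq => /eqP. Qed.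

Lemma mpolyX_neq0 (R : nzRingType) (n : nat) (m : 'X_{1..n}) : 'X_[R, m] != 0.
Proof. by rewrite -msupp_eq0 msuppX. Qed.

Definition frac_const (K : fieldType) (n : nat) :
    {rmorphism K -> {fraction {mpoly K[n]}}} :=
  @FracField.tofrac {mpoly K[n]} \o @mpolyC n K.

(** * Flows of vector fields *)

Section Flow.
Variables (K : numFieldType) (n : nat).
Implicit Types (c : 'I_n -> {mpoly K[n]}) (p : {mpoly K[n]}).

(** The substitution v -> v + s c(v), with the time s kept as the variable of
    the target {poly _}. *)
Definition flow c : {mpoly K[n]} -> {poly {mpoly K[n]}} :=
  mmap (polyC \o @mpolyC n K) (fun v => ('X_v)%:P + (c v)%:P * 'X).

HB.instance Definition _ c := GRing.RMorphism.on (flow c).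

Lemma flowC c a : flow c a%:MP = a%:MP%:P.
Proof. by rewrite /flow mmapC. Qed.

Lemma flowX c v : flow c 'X_v = ('X_v)%:P + (c v)%:P * 'X.
Proof. by rewrite /flow mmapX mmap1U. Qed.

Lemma flowD c : {morph flow c : p q / p + q}.
Proof. exact: rmorphD. Qed.

Lemma flowM c : {morph flow c : p q / p * q}.
Proof. exact: rmorphM. Qed.

Lemma flow_eval c (L : comNzRingType) (h : {rmorphism K -> L}) (M : 'I_n -> L)
    (s : L) p :
  (map_poly (mmap h M) (flow c p)).[s]
  = mmap h (fun v => M v + mmap h M (c v) * s) p.
Proof.
pose ev := horner_eval s \o map_poly (mmap h M) \o flow c.
suff: ev =1 mmap h (fun v => M v + mmap h M (c v) * s) by apply.
apply: mmap_unique => [a|v] /=.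
  by rewrite flowC map_polyC /= !mmapC /horner_eval hornerC.
rewrite flowX rmorphD rmorphM /= map_polyX !map_polyC /= !mmapX !mmap1U.
by rewrite /horner_eval !hornerE.
Qed.

(** An identity in {poly _} specializes to any time in any commutative algebra:
    invariance over K becomes invariance over the fraction fields in which the
    normal forms live. *)
Lemma flow_invariant_eval c (L : comNzRingType) (h : {rmorphism K -> L})
    (M : 'I_n -> L) (s : L) p : flow c p = p%:P ->
  mmap h (fun v => M v + mmap h M (c v) * s) p = mmap h M p.
Proof. by move=> inv_p; rewrite -flow_eval inv_p map_polyC hornerC. Qed.

Lemma flow_horner c (s : K) p :
  (flow c p).[s%:MP] = mmap (@mpolyC n K) (fun v => 'X_v + s *: c v) p.
Proof.
have idE q : mmap (@mpolyC n K) (fun v => 'X_v) q = q.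
  rewrite -[RHS](comp_mpoly_id q); apply: eq_mmap => v.
  by rewrite tnth_mktuple.
rewrite -[flow c p](@map_poly_id _ (mmap (@mpolyC n K) (fun v => 'X_v))).
  rewrite flow_eval; apply: eq_mmap => v /=.
  by rewrite idE mulrC mul_mpolyC.
by move=> q _; apply: idE.
Qed.

(** A polynomial in s that is constant at the infinitely many integers is
    constant. *)
Lemma flow_invariant_of_points c p :
  (forall s : K, mmap (@mpolyC n K) (fun v => 'X_v + s *: c v) p = p) ->
  flow c p = p%:P.
Proof.
move=> inv_p; apply/eqP; rewrite -subr_eq0; apply/eqP.
set r := _ - _.
apply: (@roots_geq_poly_eq0 _ r [seq (i%:R : K)%:MP | i <- iota 0 (size r)]).
- apply/allP => _ /mapP[i _ ->]; rewrite /root /r hornerD hornerN hornerC.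
  by rewrite flow_horner inv_p subrr.
- rewrite map_inj_uniq ?iota_uniq // => i j /eqP; rewrite mpolyC_eq.
  by rewrite eqr_nat => /eqP.
- by rewrite size_map size_iota.
Qed.

Definition vfield c p : {mpoly K[n]} := \sum_v c v * p^`M(v).

Lemma vfieldD c p q : vfield c (p + q) = vfield c p + vfield c q.
Proof.
rewrite /vfield -big_split /=; apply: eq_bigr => v _.
by rewrite mderivD mulrDr.
Qed.

Lemma vfieldM c p q : vfield c (p * q) = vfield c p * q + p * vfield c q.
Proof.
rewrite /vfield mulr_suml mulr_sumr -big_split /=; apply: eq_bigr => v _.
by rewrite mderivM; ring.
Qed.

Lemma vfieldC c a : vfield c a%:MP = 0.
Proof. by rewrite /vfield big1 // => v _; rewrite mderivC mulr0. Qed.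

Lemma vfieldX c v : vfield c 'X_v = c v.
Proof.
rewrite /vfield (bigD1 v) //= big1 ?addr0 => [|u /negPf uv].
  rewrite mderivX mnm1E eqxx scale1r.
  suff -> : (U_(v) - U_(v))%MM = 0%MM :> 'X_{1..n} by rewrite mpolyX0 mulr1.
  by apply/mnmP => i; rewrite mnmBE mnm0E subnn.
by rewrite mderivX mnm1E eq_sym uv scale0r mulr0.
Qed.

(** The flow equation d/ds p(v + s c) = (D p)(v + s c) for the vector field D
    with components c; it needs c to be constant along its own flow. *)
Lemma deriv_flow c p : (forall v, flow c (c v) = (c v)%:P) ->
  (flow c p)^`() = flow c (vfield c p).
Proof.
move=> cK; elim/mpoly_ring_ind: p => [a|v|p q IHp IHq|p q IHp IHq].
- by rewrite flowC derivC vfieldC rmorph0.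
- rewrite vfieldX cK flowX derivD derivC derivM derivX derivC.
  by rewrite mul0r mulr1 !add0r.
- rewrite vfieldD.
  rewrite [in RHS]flowD.
  rewrite -IHp.
  rewrite -IHq.
  rewrite [in LHS]flowD.
  by rewrite derivD.
- rewrite vfieldM.
  rewrite [in RHS]flowD.
  rewrite (flowM c (vfield c p) q) (flowM c p (vfield c q)).
  rewrite -IHp -IHq.
  rewrite (flowM c p q).
  by rewrite derivM.
Qed.

Lemma flow_invariant_of_vfield c p : (forall v, flow c (c v) = (c v)%:P) ->
  vfield c p = 0 -> flow c p = p%:P.
Proof.
move=> cK Dp; have := deriv_flow p cK; rewrite Dp rmorph0 => d0.
have pz : flow c p = ((flow c p)`_0)%:P.
  apply/polyP => -[|i]; rewrite coefC //=.
  have := coef_deriv (flow c p) i; rewrite d0 coef0 => /eqP.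
  rewrite eq_sym -mulr_natr mulf_eq0 => /orP[/eqP //|].
  by rewrite -[_%:R]mpolyC_nat mpolyC_eq0 pnatr_eq0.
rewrite pz; congr _%:P; rewrite -horner_coef0 -mpolyC0 flow_horner.
rewrite -[RHS](comp_mpoly_id p); apply: eq_mmap => v /=.
by rewrite scale0r addr0 tnth_mktuple.
Qed.

End Flow.

(** * The Fischer product *)

Section Fischer.
Variables (K : numClosedFieldType) (n : nat).
Implicit Types p q r : {mpoly K[n]}.

Definition mfact (m : 'X_{1..n}) : K := \prod_i (m i)`!%:R.

(** The apolar hermitian product, p(d/dX) applied to the conjugate of q and
    evaluated at 0. *)
Definition fischer p q : K := \sum_(m <- msupp p) p@_m * (q@_m)^* * mfact m.

Lemma fischer_supp (s : seq 'X_{1..n}) p q : uniq s -> {subset msupp p <= s} ->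
  fischer p q = \sum_(m <- s) p@_m * (q@_m)^* * mfact m.
Proof.
move=> us ps; rewrite /fischer [RHS](bigID (mem (msupp p))) /=.
rewrite [X in _ + X]big1 ?addr0 => [|m]; last first.
  by move=> /memN_msupp_eq0 ->; rewrite !mul0r.
rewrite -[RHS]big_filter; apply: perm_big.
apply: uniq_perm; rewrite ?msupp_uniq ?filter_uniq // => m.
by rewrite mem_filter /= andb_idr // => /ps.
Qed.

Lemma mfact_gt0 (m : 'X_{1..n}) : 0 < mfact m.
Proof. by apply: prodr_gt0 => i _; rewrite ltr0n fact_gt0. Qed.

Lemma mfactU (m : 'X_{1..n}) v : mfact (m + U_(v))%MM = (m v).+1%:R * mfact m.
Proof.
rewrite /mfact (bigD1 v) //= [in RHS](bigD1 v) //= mulrA; congr (_ * _).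
  by rewrite mnmDE mnm1E eqxx addn1 factS natrM.
apply: eq_bigr => i iv; rewrite mnmDE mnm1E eq_sym (negPf iv).
by rewrite addn0.
Qed.

Lemma fischerC p q : fischer q p = (fischer p q)^*.
Proof.
pose s := undup (msupp p ++ msupp q).
rewrite !(@fischer_supp s) ?undup_uniq //; last 2 first.
- by move=> m mp; rewrite mem_undup mem_cat mp.
- by move=> m mp; rewrite mem_undup mem_cat mp orbT.
rewrite rmorph_sum; apply: eq_bigr => m _.
rewrite !rmorphM /= conjCK [(mfact m)^*]geC0_conj; first by ring.
exact: ltW (mfact_gt0 m).
Qed.

Lemma fischerDr p q r : fischer p (q + r) = fischer p q + fischer p r.
Proof.
rewrite /fischer -big_split /=; apply: eq_bigr => m _.
by rewrite mcoeffD rmorphD /=; ring.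
Qed.

Lemma fischerZr a p q : fischer p (a *: q) = a^* * fischer p q.
Proof.
rewrite /fischer mulr_sumr; apply: eq_bigr => m _.
by rewrite mcoeffZ rmorphM /=; ring.
Qed.

Lemma fischer0r p : fischer p 0 = 0.
Proof. by rewrite -(scale0r (0 : {mpoly K[n]})) fischerZr conjC0 mul0r. Qed.

Lemma fischerDl p q r : fischer (q + r) p = fischer q p + fischer r p.
Proof. by rewrite fischerC fischerDr rmorphD /= -!fischerC. Qed.

Lemma fischerZl a p q : fischer (a *: p) q = a * fischer p q.
Proof. by rewrite fischerC fischerZr rmorphM /= conjCK -fischerC. Qed.

Lemma fischer_eq0 p : fischer p p = 0 -> p = 0.
Proof.
move=> pp0; apply/mpolyP => m; rewrite mcoeff0; apply/eqP.
have [mp|] := boolP (m \in msupp p); last by rewrite mcoeff_eq0.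
have ge0 m' : 0 <= p@_m' * (p@_m')^* * mfact m'.
  by rewrite mulr_ge0 ?mul_conjC_ge0 // ltW // mfact_gt0.
move/eqP: pp0; rewrite /fischer psumr_eq0 // => /allP/(_ _ mp).
rewrite /= mulf_eq0 (gt_eqF (mfact_gt0 m)) orbF.
by rewrite mul_conjC_eq0.
Qed.

(** Multiplication by a variable is adjoint to the derivation along it. *)
Lemma fischer_mulX v p q : fischer ('X_v * p) q = fischer p q^`M(v).
Proof.
rewrite mulrC /fischer (perm_big _ (msuppMX p U_(v))) big_map /=.
apply: eq_bigr => m _.
rewrite mcoeffMX mcoeff_deriv addmC mfactU raddfMn -mulr_natr /=.
by ring.
Qed.

Lemma fischer_deriv v p q : fischer p^`M(v) q = fischer p ('X_v * q).
Proof. by rewrite fischerC -fischer_mulX -fischerC. Qed.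

(** Induction on the monomials allowed in P.  The subspace P' of the elements of
    P without the monomial m has a projection by induction, and either P' = P or
    P is spanned by P' and one vector, which Gram-Schmidt makes orthogonal to
    P'. *)
Lemma orthogonal_projection (P : {mpoly K[n]} -> Prop) (s : seq 'X_{1..n}) :
  P 0 -> (forall a p q, P p -> P q -> P (a *: p + q)) ->
  (forall p, P p -> {subset msupp p <= s}) ->
  forall p, exists2 q, P q & forall r, P r -> fischer (p - q) r = 0.
Proof.
elim: s P => [|m s IH] P P0 Plin Ps p.
  exists 0 => // r /Ps rs; suff -> : r = 0 by rewrite fischer0r.
  by apply/eqP; rewrite -msupp_eq0; case: (msupp r) rs => // a l /(_ a (mem_head _ _)).
pose P' r := P r /\ r@_m = 0.
have IH' q : exists2 q', P' q' & forall r, P' r -> fischer (q - q') r = 0.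
  apply: IH => [|a q1 q2 [P1 q10] [P2 q20]|r [/Ps rs r0] m' m'r].
  - by split; rewrite ?mcoeff0.
  - split; first exact: Plin.
    by rewrite mcoeffD mcoeffZ q10 q20 mulr0 addr0.
  - have := rs _ m'r; rewrite inE => /orP[/eqP E|//].
    by move: m'r; rewrite mcoeff_msupp E r0 eqxx.
have [noP|] := classic (forall r, P r -> r@_m = 0).
  have [q [Pq _] qO] := IH' p; exists q => // r Pr.
  by apply: qO; split=> //; apply: noP.
move=> /not_all_ex_not[g /(imply_to_and (P g) _)[Pg]] /eqP gm0.
have [g0 [Pg0 g0m] g0O] := IH' g; have [q0 [Pq0 q0m] q0O] := IH' p.
(* e spans the orthogonal complement of P' in P. *)
pose e := g - g0.
have Pe : P e by rewrite /e -scaleN1r addrC; apply: Plin.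
have em : e@_m = g@_m by rewrite mcoeffB g0m subr0.
have ee0 : fischer e e != 0.
  by apply/eqP => /fischer_eq0 e0; rewrite -em e0 mcoeff0 eqxx in gm0.
pose b := fischer p e / fischer e e.
exists (b *: e + q0) => [|r Pr]; first exact: Plin.
pose a := r@_m / e@_m.
have P'r : P' (r - a *: e).
  split; first by rewrite -scaleNr addrC; apply: Plin.
  by rewrite mcoeffB mcoeffZ divfK ?em // subrr.
have bilin u v w : fischer (u - (b *: e + v)) w
    = fischer (u - v) w - b * fischer e w.
  rewrite -[_ - (_ + _)]/(_ + _) -scaleN1r scalerDr scalerA mulN1r addrCA addrC.
  by rewrite scaleN1r fischerDl fischerZl mulNr.
rewrite -[r](subrK (a *: e)) fischerDr !bilin q0O // fischerZr.
rewrite (g0O _ P'r) fischerZr.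
have -> : fischer (p - q0) e = fischer p e.
  rewrite fischerDl -scaleN1r fischerZl [fischer q0 e]fischerC.
  by rewrite g0O // conjC0 mulr0 addr0.
by rewrite /b; field.
Qed.
End Fischer.

(** * Points of the space of 3-jets *)

Lemma ord3P (P : 'I_3 -> Prop) : P 0 -> P 1 -> P 2%:R -> forall i, P i.
Proof.
by move=> P0 P1 P2 [[|[|[|//]]] ltj]; [move: P0 | move: P1 | move: P2];
  congr P; apply: val_inj.
Qed.

Lemma ord4P (P : 'I_4 -> Prop) : P 0 -> P 1 -> P 2%:R -> P 3%:R -> forall i, P i.
Proof.
by move=> P0 P1 P2 P3 [[|[|[|[|//]]]] ltj]; [move: P0|move: P1|move: P2|move: P3];
  congr P; apply: val_inj.
Qed.

Lemma big_ord3 (V : nmodType) (F : 'I_3 -> V) : \sum_i F i = F 0 + F 1 + F 2%:R.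
Proof.
rewrite !big_ord_recl big_ord0 addr0 addrA.
by congr (_ + F _ + F _); apply: val_inj.
Qed.

Lemma det_mx3 (S : comNzRingType) (A : 'M[S]_3) :
  \det A = A 0 0 * (A 1 1 * A 2%:R 2%:R - A 1 2%:R * A 2%:R 1)
         - A 0 1 * (A 1 0 * A 2%:R 2%:R - A 1 2%:R * A 2%:R 0)
         + A 0 2%:R * (A 1 0 * A 2%:R 1 - A 1 1 * A 2%:R 0).
Proof.
rewrite (expand_det_row _ 0) big_ord3 /cofactor !(expand_det_row _ 0) /cofactor.
rewrite !big_ord_recl !big_ord0 !det_mx11 !mxE.
do ![rewrite (_ : lift _ _ = 0); last exact: val_inj
   | rewrite (_ : lift _ _ = 1); last exact: val_inj
   | rewrite (_ : lift _ _ = 2%:R); last exact: val_inj].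
ring.
Qed.

Definition entries (S : Type) (M : 'I_3 -> 'I_3 -> S) (v : 'I_(3 * 3)) : S :=
  mxvec (\matrix_(r, i) M r i) 0 v.

Lemma entriesE (S : Type) (M : 'I_3 -> 'I_3 -> S) r i :
  entries M (mxvec_index r i) = M r i.
Proof. by rewrite /entries mxvecE mxE. Qed.

Section Evaluation.
Variables (K : numFieldType) (L : comNzRingType) (h : {rmorphism K -> L}).
Variable M : 'I_3 -> 'I_3 -> L.

Definition jet_eval : jet_ring K 3 3 -> L := mmap h (entries M).

HB.instance Definition _ := GRing.RMorphism.on jet_eval.

Lemma jet_evalC c : jet_eval c%:MP = h c.
Proof. exact: mmapC. Qed.

Lemma jet_eval_dvar r i : jet_eval (dvar K r i) = M r i.
Proof. by rewrite /jet_eval mmapX mmap1U entriesE. Qed.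

Lemma jet_eval_w2 i j : jet_eval (w2 K i j) = M 0 i * M 1 j - M 1 i * M 0 j.
Proof. by rewrite /w2 rmorphB !rmorphM /= !jet_eval_dvar. Qed.

Lemma jet_eval_w3 k i j : jet_eval (w3 K k i j)
  = M 0 k * (M 0 i * M 2%:R j - M 2%:R i * M 0 j)
    - 3%:R * M 1 k * (M 0 i * M 1 j - M 1 i * M 0 j).
Proof.
by rewrite /w3 rmorphB !rmorphM !rmorphB !rmorphM rmorph_nat /= !jet_eval_dvar.
Qed.

Lemma jet_eval_wronskian : jet_eval (wronskian K)
  = M 0 0 * (M 1 1 * M 2%:R 2%:R - M 1 2%:R * M 2%:R 1)
    - M 0 1 * (M 1 0 * M 2%:R 2%:R - M 1 2%:R * M 2%:R 0)
    + M 0 2%:R * (M 1 0 * M 2%:R 1 - M 1 1 * M 2%:R 0).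
Proof.
rewrite /wronskian -det_map_mx det_mx3 !mxE.
by rewrite /= !jet_eval_dvar.
Qed.

End Evaluation.

Lemma jet_eval_ext (K : numFieldType) (L : comNzRingType) (h : {rmorphism K -> L})
  (M N : 'I_3 -> 'I_3 -> L) p : (forall r i, M r i = N r i) ->
  jet_eval h M p = jet_eval h N p.
Proof.
move=> MN; apply: eq_mmap => v; case/mxvec_indexP: v => r i.
by rewrite !entriesE.
Qed.

(** The form in which invariance is used: p takes the same value at M and at the
    point reached from M along the flow, over any extension of K. *)
Lemma jet_eval_flow (K : numFieldType) (L : comNzRingType) (h : {rmorphism K -> L})
    (M : 'I_3 -> 'I_3 -> L) (C : 'I_3 -> 'I_3 -> jet_ring K 3 3) (s : L) p :
  flow (entries C) p = p%:P ->
  jet_eval h (fun r i => M r i + jet_eval h M (C r i) * s) p = jet_eval h M p.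
Proof.
move=> inv_p; rewrite /jet_eval -[RHS](flow_invariant_eval h _ s inv_p).
by apply: eq_mmap => v; case/mxvec_indexP: v => r i; rewrite !entriesE.
Qed.

(** * Polarization operators *)

Section Polarization.
Variable K : numFieldType.
Local Notation ring := (jet_ring K 3 3).
Implicit Types (p q : ring) (a b : 'I_3).

Definition polar_field a b : 'I_(3 * 3) -> ring :=
  entries (fun r i => if i == a then dvar K r b else 0).

(** The infinitesimal column operation X_ra -> X_ra + s X_rb. *)
Definition polar a b : ring -> ring := vfield (polar_field a b).

Lemma polar_dvar a b r i : polar a b (dvar K r i) = if i == a then dvar K r b else 0.
Proof. by rewrite /polar vfieldX /polar_field entriesE. Qed.

Lemma polarE a b p : polar a b p = \sum_r dvar K r b * p^`M(mxvec_index r a).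
Proof.
rewrite /polar /vfield (reindex _ (curry_mxvec_bij 3 3)) /=.
transitivity (\sum_r \sum_i polar_field a b (mxvec_index r i)
                                * p^`M(mxvec_index r i)).
  by rewrite pair_bigA; apply: eq_bigr => -[].
apply: eq_bigr => r _; rewrite (bigD1 a) //= /polar_field entriesE eqxx.
by rewrite big1 ?addr0 // => i /negPf ia; rewrite entriesE ia mul0r.
Qed.

(** In each monomial, one factor X_ra is replaced by X_rb. *)
Lemma polar_measure (mf : measure (3 * 3)) (k : nat) a b p :
  (forall r, mf U_(mxvec_index r b)%MM + k <= mf U_(mxvec_index r a)%MM)%N ->
  (mmeasure mf (polar a b p) <= mmeasure mf p - k)%N.
Proof.
move=> mfk; rewrite mmeasureE; apply/bigmax_leqP_seq => m + _.
rewrite polarE => /msupp_sum_le/flattenP[_ /mapP[r _ ->]].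
rewrite mulrC (perm_mem (msuppMX _ _)) => /mapP[m' m'p ->].
have : (m' + U_(mxvec_index r a))%MM \in msupp p.
  by move: m'p; rewrite !mcoeff_msupp mcoeff_deriv; apply: contra_neq => ->; rewrite mul0rn.
move=> /(@mmeasure_mnm_lt _ _ mf); rewrite !mfD.
have := mfk r; lia.
Qed.

(** The variables of column i have weight i, whatever their row: polarization
    towards a column of smaller index decreases the weight. *)
Definition column_weight (m : 'X_{1..3 * 3}) : nat :=
  \sum_v m v * entries (fun _ i => nat_of_ord i) v.

Lemma column_weight0 : column_weight 0%MM = 0%N.
Proof. by rewrite /column_weight big1 // => v _; rewrite mnm0E. Qed.

Lemma column_weightD : {morph column_weight : m1 m2 / (m1 + m2)%MM >-> (m1 + m2)%N}.
Proof.
move=> m1 m2; rewrite /column_weight -big_split /=; apply: eq_bigr => v _.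
by rewrite mnmDE mulnDl.
Qed.

HB.instance Definition _ := isMeasure.Build (3 * 3) column_weight column_weight0 column_weightD.

Lemma column_weightU r i : column_weight U_(mxvec_index r i)%MM = i.
Proof.
rewrite /column_weight (bigD1 (mxvec_index r i)) //= mnm1E eqxx mul1n entriesE.
by rewrite big1 ?addn0 // => v /negPf vi; rewrite mnm1E eq_sym vi.
Qed.

Lemma mmeasure_polar_lt a b p : (b < a)%N -> polar a b p != 0 ->
  (mmeasure column_weight (polar a b p) < mmeasure column_weight p)%N.
Proof.
move=> ba nz.
have : (mmeasure column_weight (polar a b p) <= mmeasure column_weight p - 1)%N.
  by apply: polar_measure => r /=; rewrite !column_weightU addn1.
by move: nz; rewrite -(mmeasure_poly_eq0 column_weight); lia.
Qed.

Lemma msize_polar a b p : (msize (polar a b p) <= msize p)%N.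
Proof.
by have := @polar_measure mdeg 0 a b p; rewrite subn0; apply=> r /=; rewrite addn0 !mdeg1.
Qed.

End Polarization.

Section PolarAdjoint.
Variable K : numClosedFieldType.
Local Notation ring := (jet_ring K 3 3).

(** Sum over the rows of the adjunction between variables and derivations. *)
Lemma fischer_polar (a b : 'I_3) (p q : ring) :
  fischer (polar a b p) q = fischer p (polar b a q).
Proof.
rewrite !polarE.
rewrite (big_morph (fun u => fischer u q) (fun u v => fischerDl q u v) (id1 := 0)).
rewrite (big_morph (fischer p) (fischerDr p) (fischer0r p)).
  by apply: eq_bigr => r _; rewrite fischer_mulX fischer_deriv.
by rewrite fischerC fischer0r conjC0.
Qed.
End PolarAdjoint.

(** * Reparametrization of 3-jets *)

Section Reparametrization.
Variable K : numFieldType.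
Local Notation ring := (jet_ring K 3 3).
Implicit Types (phi : {poly K}) (Q : ring).

Lemma reparamE phi Q :
  reparam phi Q = jet_eval (@mpolyC (3 * 3) K) (reparam_dvar phi) Q.
Proof. by apply: eq_mmap => v; rewrite tnth_mktuple. Qed.

(** Chain rule for t -> c t. *)
Lemma derivn_comp_scale (S : comNzRingType) (p : {poly S}) (c : S) n :
  (p \Po (c *: 'X))^`(n) = c ^+ n *: (p^`(n) \Po (c *: 'X)).
Proof.
elim: n => [|n IH]; first by rewrite scale1r.
rewrite derivnS IH derivZ deriv_comp derivZ derivX -derivnS alg_polyC.
by rewrite mulrC mul_polyC scalerA exprSr.
Qed.

Lemma reparam_dvar_scale (psi : {poly K}) (a : K) (j i : 'I_3) :
  reparam_dvar (psi \Po (a *: 'X)) j i = a%:MP ^+ j.+1 * reparam_dvar psi j i.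
Proof.
rewrite /reparam_dvar map_comp_poly map_polyZ map_polyX comp_polyA.
by rewrite derivn_comp_scale hornerZ horner_comp !hornerE.
Qed.

Lemma cubic_poly (S : nzRingType) (p : {poly S}) : (size p <= 4)%N ->
  p.[0] = 0 -> p = p`_1 *: 'X + p`_2 *: 'X^2 + p`_3 *: 'X^3.
Proof.
move=> sp p0; apply/polyP => i; rewrite !coefD !coefZ coefX !coefXn.
case: i => [|[|[|[|i]]]] /=; rewrite ?(mulr0, mulr1, addr0, add0r) //.
  by rewrite -horner_coef0.
by rewrite nth_default // (leq_trans sp).
Qed.

Lemma deriv_horner0 (S : nzRingType) (p : {poly S}) : p^`().[0] = p`_1.
Proof. by rewrite horner_coef0 coef_deriv. Qed.

(** A jet of biholomorphism a t + b t^2 + c t^3 is the unipotent one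
    t + (b/a^2) t^2 + (c/a^3) t^3 composed with t -> a t, and the latter
    multiplies derivatives of order j by a^j. *)
Lemma biholo_reparam_dvar phi : biholo_jet 3 phi ->
  exists s t : K, forall i,
  let a := (phi^`().[0])%:MP in
  [/\ reparam_dvar phi 0 i = a * d1 K i,
      reparam_dvar phi 1 i = a ^+ 2 * (d2 K i + s%:MP * d1 K i)
    & reparam_dvar phi 2%:R i
      = a ^+ 3 * (d3 K i + 3%:R * s%:MP * d2 K i + t%:MP * d1 K i)].
Proof.
rewrite /biholo_jet deriv_horner0 => -[sz /(cubic_poly sz)].
set a := phi`_1; set b := phi`_2; set c := phi`_3 => -> a0.
pose psi : {poly K} := 'X + (b / a ^+ 2) *: 'X^2 + (c / a ^+ 3) *: 'X^3.
have -> : a *: 'X + b *: 'X^2 + c *: 'X^3 = psi \Po (a *: 'X).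
  rewrite /psi !comp_polyD !comp_polyZ comp_polyX !comp_Xn_poly !exprZn !scalerA.
  by rewrite !divfK // expf_neq0.
exists (2%:R * (b / a ^+ 2)), (6%:R * (c / a ^+ 3)) => i.
rewrite /= !reparam_dvar_scale.
have [-> -> ->] := reparam_dvar3 (b / a ^+ 2) (c / a ^+ 3) i.
rewrite -!mul_mpolyC expr1; split=> //.
  congr (_ * (_ + _ * _ + _)).
  by rewrite -[3%:R]mpolyC_nat -mpolyCM (mulrA 3%:R) -natrM.
Qed.

(** The linear vector fields c for which v + s c(v) is the action of the jet
    t + (s/2) t^2 (for [shear_y]) and t + (s/6) t^3 (for [shear_z]); these two
    families of jets generate G_3'. *)
Definition shear_y : 'I_3 -> 'I_3 -> ring := fun r i =>
  if r == 1 then d1 K i else if r == 2%:R then 3%:R * d2 K i else 0.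

Definition shear_z : 'I_3 -> 'I_3 -> ring := fun r i =>
  if r == 2%:R then d1 K i else 0.

Lemma unipotent_jet_cubic (b c : K) :
  unipotent_jet 3 ('X + b *: 'X^2 + c *: 'X^3).
Proof.
split.
- rewrite (leq_trans (size_polyD _ _)) // geq_max.
  rewrite (leq_trans (size_polyD _ _)) ?geq_max ?size_polyX /=;
    by rewrite (leq_trans (size_scale_leq _ _)) ?size_polyXn.
- by rewrite horner_coef0 !coefD !coefZ coefX !coefXn /= !mulr0 !addr0.
- rewrite deriv_horner0 !coefD !coefZ coefX !coefXn /=.
  by rewrite !mulr0 !addr0.
Qed.

Lemma unipotent_invariant_shear Q : unipotent_invariant Q ->
  flow (entries shear_y) Q = Q%:P /\ flow (entries shear_z) Q = Q%:P.
Proof.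
move=> invQ; split; apply: flow_invariant_of_points => s.
- rewrite -[RHS](invQ ('X + (s / 2%:R) *: 'X^2 + 0 *: 'X^3)); last first.
    exact: unipotent_jet_cubic.
  rewrite reparamE; apply: eq_mmap => v; case/mxvec_indexP: v => r i.
  have [E1 E2 E3] := reparam_dvar3 (s / 2%:R) 0 i.
  rewrite !entriesE /shear_y; elim/ord3P: r; rewrite /=.
  + by rewrite E1 scaler0 addr0.
  + by rewrite E2 mulrC divfK // pnatr_eq0.
  + rewrite E3 mulr0 scale0r addr0; congr (_ + _).
    rewrite -!mul_mpolyC -[3%:R]mpolyC_nat mulrA -mpolyCM.
    by congr (_%:MP * _); field.
- rewrite -[RHS](invQ ('X + 0 *: 'X^2 + (s / 6%:R) *: 'X^3)); last first.
    exact: unipotent_jet_cubic.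
  rewrite reparamE; apply: eq_mmap => v; case/mxvec_indexP: v => r i.
  have [E1 E2 E3] := reparam_dvar3 0 (s / 6%:R) i.
  rewrite !entriesE /shear_z; elim/ord3P: r; rewrite /=.
  + by rewrite E1 scaler0 addr0.
  + by rewrite E2 mulr0 scale0r scaler0.
  + by rewrite E3 mulr0 scale0r addr0 mulrC divfK // pnatr_eq0.
Qed.

Lemma unipotent_biholo phi : unipotent_jet 3 phi -> biholo_jet 3 phi.
Proof. by case=> sz p0 p1; split=> //; rewrite p1 oner_eq0. Qed.

End Reparametrization.

(** * The generators and the algebra they span *)

Section SubalgGen.
Variables (K : comNzRingType) (A : algType K) (G : A -> Prop).
Implicit Types p q : A.

Lemma subalg_gen0 : subalg_gen G 0.
Proof. by rewrite -(scale0r 1); apply: SubalgScalar. Qed.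

Lemma subalg_genZ c p : subalg_gen G p -> subalg_gen G (c *: p).
Proof. by move=> Gp; rewrite -mulr_algl; apply: SubalgMul => //; apply: SubalgScalar. Qed.

Lemma subalg_genN p : subalg_gen G p -> subalg_gen G (- p).
Proof. by rewrite -scaleN1r; apply: subalg_genZ. Qed.

End SubalgGen.

Section Generators.
Variable K : numFieldType.
Local Notation ring := (jet_ring K 3 3).
Local Notation B := (subalg_gen (@jet_generator K)).
Implicit Types (phi : {poly K}) (p q : ring) (a b : 'I_3).

Lemma reparamC phi c : reparam phi (c%:MP : ring) = c%:MP.
Proof. by rewrite reparamE jet_evalC. Qed.

Lemma reparam0 phi : reparam phi (0 : ring) = 0.
Proof. by rewrite -mpolyC0 reparamC. Qed.

Lemma reparamD phi p q : reparam phi (p + q) = reparam phi p + reparam phi q.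
Proof. by rewrite !reparamE rmorphD. Qed.

Lemma reparamM phi p q : reparam phi (p * q) = reparam phi p * reparam phi q.
Proof. by rewrite !reparamE rmorphM. Qed.

(** The weights are 1 for f_l', 3 for w_ij, 5 for w_ij^k and 6 for W. *)
Lemma generator_invariant (g : ring) : jet_generator g ->
  exists m, invariant_jet_diff m g.
Proof.
case=> [l|i j _|k i j _|]; [exists 1%N|exists 3%N|exists 5%N|exists 6%N] => phi;
  move=> /biholo_reparam_dvar[s [t E]]; rewrite reparamE -mul_mpolyC rmorphXn /=.
- by rewrite jet_eval_dvar; case: (E l).
- rewrite jet_eval_w2; have [-> -> _] := E i; have [-> -> _] := E j.
  by rewrite /w2; ring.
- rewrite jet_eval_w3; have [-> -> ->] := E i; have [-> _ ->] := E j.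
  by have [-> -> _] := E k; rewrite /w3; have [_ -> _] := E j; ring.
- rewrite jet_eval_wronskian /wronskian det_mx3 !mxE.
  have [-> -> ->] := E 0; have [-> -> ->] := E 1; have [-> -> ->] := E 2%:R.
  by rewrite -!/(d1 K _) -!/(d2 K _) -!/(d3 K _); ring.
Qed.

Lemma jet_diff_algebraD p q :
  jet_diff_algebra p -> jet_diff_algebra q -> jet_diff_algebra (p + q).
Proof.
move=> [d [f [fi ->]]] [e [g [gi ->]]].
pose f' m := if (m < d)%N then f m else 0.
pose g' m := if (m < e)%N then g m else 0.
exists (d + e)%N, (fun m => f' m + g' m); split=> [m phi bphi|].
  rewrite reparamD scalerDr /f' /g'; congr (_ + _); case: ifP => _.
  - exact: fi.
  - by rewrite scaler0 reparam0.
  - exact: gi.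
  - by rewrite scaler0 reparam0.
rewrite big_split /= (big_ord_widen (d + e)) ?leq_addr // big_mkcond.
by rewrite [X in _ + X](big_ord_widen (d + e)) ?leq_addl // [X in _ + X]big_mkcond.
Qed.

Lemma invariant_jet_diff_algebra m p : invariant_jet_diff m p -> jet_diff_algebra p.
Proof.
move=> pi; exists m.+1, (fun l => if l == m then p else 0); split=> [l phi bphi|].
  by case: eqP => [->|_]; [apply: pi | rewrite scaler0 reparam0].
rewrite big_ord_recr /= eqxx big1 ?add0r // => i _.
by rewrite ltn_eqF.
Qed.

Lemma jet_diff_algebra0 : jet_diff_algebra (0 : ring).
Proof. by exists 0%N, (fun=> 0); split=> [m phi _|]; rewrite ?big_ord0 // scaler0 reparam0. Qed.

Lemma jet_diff_algebraM p q :
  jet_diff_algebra p -> jet_diff_algebra q -> jet_diff_algebra (p * q).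
Proof.
move=> [d [f [fi ->]]] [e [g [gi ->]]]; rewrite mulr_suml.
apply: (big_ind (@jet_diff_algebra K 3 3)) => [||i _].
- exact: jet_diff_algebra0.
- exact: jet_diff_algebraD.
rewrite mulr_sumr; apply: (big_ind (@jet_diff_algebra K 3 3)) => [||j _].
- exact: jet_diff_algebra0.
- exact: jet_diff_algebraD.
apply: (@invariant_jet_diff_algebra (i + j)) => phi bphi.
by rewrite reparamM fi // gi // -scalerAl -scalerAr scalerA exprD.
Qed.

Lemma subalg_gen_jet_diff_algebra p : B p -> jet_diff_algebra p.
Proof.
elim=> [c|g /generator_invariant[m]|r q _ IHr _ IHq|r q _ IHr _ IHq].
- apply: (@invariant_jet_diff_algebra 0) => phi _.
  by rewrite expr0 scale1r -mul_mpolyC mulr1 reparamC.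
- exact: invariant_jet_diff_algebra.
- exact: jet_diff_algebraD.
- exact: jet_diff_algebraM.
Qed.

Lemma jet_diff_algebra_unipotent p : jet_diff_algebra p -> unipotent_invariant p.
Proof.
move=> [d [f [fi ->]]] phi uphi; have [_ _ p1] := uphi.
elim/big_ind: _ => [|r q Er Eq|i _].
- by rewrite reparam0.
- by rewrite reparamD Er Eq.
- by rewrite (fi i phi (unipotent_biholo uphi)) p1 expr1n scale1r.
Qed.

Lemma polarD a b p q : polar a b (p + q) = polar a b p + polar a b q.
Proof. exact: vfieldD. Qed.

Lemma polarM a b p q : polar a b (p * q) = polar a b p * q + p * polar a b q.
Proof. exact: vfieldM. Qed.

Lemma polarC a b c : polar a b (c%:MP : ring) = 0.
Proof. exact: vfieldC. Qed.

Lemma polarZ a b c p : polar a b (c *: p) = c *: polar a b p.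
Proof. by rewrite -!mul_mpolyC polarM polarC mul0r add0r. Qed.

Lemma polarN a b p : polar a b (- p) = - polar a b p.
Proof. by rewrite -scaleN1r polarZ scaleN1r. Qed.

Lemma polar_nat a b n : polar a b (n%:R : ring) = 0.
Proof. by rewrite -mpolyC_nat polarC. Qed.

Lemma subalg_w2 i j : B (w2 K i j).
Proof.
case: (ltngtP i j) => [ij|ji|/val_inj ->].
- by apply: SubalgGen; apply: GenW2.
- have -> : w2 K i j = - w2 K j i by rewrite /w2; ring.
  by apply: subalg_genN; apply: SubalgGen; apply: GenW2.
- have -> : w2 K j j = 0 by rewrite /w2; ring.
  exact: subalg_gen0.
Qed.

Lemma subalg_w3 k i j : B (w3 K k i j).
Proof.
case: (ltngtP i j) => [ij|ji|/val_inj ->].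
- by apply: SubalgGen; apply: GenW3.
- have -> : w3 K k i j = - w3 K k j i by rewrite /w3; ring.
  by apply: subalg_genN; apply: SubalgGen; apply: GenW3.
- have -> : w3 K k j j = 0 by rewrite /w3; ring.
  exact: subalg_gen0.
Qed.

Lemma polar_d1 a b i : polar a b (d1 K i) = if i == a then d1 K b else 0.
Proof. exact: polar_dvar. Qed.

Lemma polar_d2 a b i : polar a b (d2 K i) = if i == a then d2 K b else 0.
Proof. exact: polar_dvar. Qed.

Lemma polar_d3 a b i : polar a b (d3 K i) = if i == a then d3 K b else 0.
Proof. exact: polar_dvar. Qed.

Definition polar_jet := (polar_d1, polar_d2, polar_d3).

(** w_ij is multilinear in the columns i and j, and a derivation acts on
    each column in turn; the same holds for w_ij^k below. *)
Lemma polar_w2 a b i j : polar a b (w2 K i j)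
  = (if i == a then w2 K b j else 0) + (if j == a then w2 K i b else 0).
Proof.
rewrite {1}/w2 !(polarD, polarN, polarM) !polar_jet /w2.
by case: eqP => _; case: eqP => _; ring.
Qed.

Lemma polar_w3 a b k i j : polar a b (w3 K k i j)
  = (if k == a then w3 K b i j else 0)
    + (if i == a then w3 K k b j else 0) + (if j == a then w3 K k i b else 0).
Proof.
rewrite {1}/w3 !(polar_nat, polarD, polarN, polarM) !polar_jet /w3.
by case: eqP => _; case: eqP => _; case: eqP => _; ring.
Qed.

Lemma wronskianE : wronskian K
  = d1 K 0 * (d2 K 1 * d3 K 2%:R - d2 K 2%:R * d3 K 1)
  - d1 K 1 * (d2 K 0 * d3 K 2%:R - d2 K 2%:R * d3 K 0)
  + d1 K 2%:R * (d2 K 0 * d3 K 1 - d2 K 1 * d3 K 0).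
Proof. by rewrite /wronskian det_mx3 !mxE. Qed.

Lemma polar_wronskian a b : a != b -> polar a b (wronskian K) = 0.
Proof.
rewrite wronskianE !(polarD, polarN, polarM) !polar_jet.
by elim/ord3P: a; elim/ord3P: b => // _; rewrite /=; ring.
Qed.

(** A polarization substitutes a column for another in f_l', w_ij and w_ij^k,
    one occurrence at a time, and it kills W, which acquires two equal columns. *)
Lemma polar_subalg a b p : a != b -> B p -> B (polar a b p).
Proof.
move=> ab; elim=> [c|_ [l|i j _|k i j _|]|r q Br IHr Bq IHq|r q Br IHr Bq IHq].
- by rewrite -mul_mpolyC mulr1 polarC; apply: subalg_gen0.
- rewrite polar_dvar; case: ifP => _; last exact: subalg_gen0.
  by apply: SubalgGen; apply: GenD1.
- rewrite polar_w2; apply: SubalgAdd; case: ifP => _;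
    by [apply: subalg_w2 | apply: subalg_gen0].
- rewrite polar_w3; apply: SubalgAdd; first apply: SubalgAdd; case: ifP => _;
    by [apply: subalg_w3 | apply: subalg_gen0].
- by rewrite polar_wronskian //; apply: subalg_gen0.
- by rewrite polarD; apply: SubalgAdd.
- by rewrite polarM; apply: SubalgAdd; apply: SubalgMul.
Qed.

(** Reparametrizations act on rows and polarizations on columns. *)
Lemma reparam_polar phi a b p : biholo_jet 3 phi ->
  reparam phi (polar a b p) = polar a b (reparam phi p).
Proof.
move=> bphi; have [s [t E]] := biholo_reparam_dvar bphi.
elim/mpoly_ring_ind: p => [c|v|p q IHp IHq|p q IHp IHq].
- by rewrite [in RHS]reparamC !polarC reparam0.
- case/mxvec_indexP: v => r i; rewrite -/(dvar K r i) polar_dvar.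
  have dvE (i' : 'I_3) : reparam phi (dvar K r i') = reparam_dvar phi r i'.
    by rewrite reparamE jet_eval_dvar.
  have -> : reparam phi (if i == a then dvar K r b else 0)
      = if i == a then reparam_dvar phi r b else 0.
    by case: ifP => _; rewrite ?dvE // reparam0.
  rewrite dvE; move: (E i) (E b) => /=; elim/ord3P: r {dvE} => [[-> _ _]|[_ -> _]|[_ _ ->]].
  + by move=> [-> _ _]; rewrite -?rmorphXn polarM polarC polar_d1; case: eqP => _; ring.
  + move=> [_ -> _]; rewrite -?rmorphXn !(polarC, polarD, polarM) !polar_jet.
    by case: eqP => _; ring.
  + move=> [_ _ ->]; rewrite -?rmorphXn !(polar_nat, polarC, polarD, polarM) !polar_jet.
    by case: eqP => _; ring.
- by rewrite polarD !reparamD IHp IHq polarD.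
- by rewrite polarM reparamD !reparamM IHp IHq polarM.
Qed.

Lemma polar_unipotent_invariant a b p :
  unipotent_invariant p -> unipotent_invariant (polar a b p).
Proof.
by move=> inv_p phi uphi; rewrite reparam_polar ?inv_p //; apply: unipotent_biholo.
Qed.

End Generators.

(** * Normal form of a point *)

Section HighestWeight.
Variables (K : numFieldType) (p : jet_ring K 3 3).
Hypotheses (p_inv : unipotent_invariant p)
  (p10 : polar 1 0 p = 0) (p21 : polar 2%:R 1 p = 0).

(** A polynomial killed by the derivation is fixed by the one-parameter group
    it generates. *)
Lemma polar_flow (a b : 'I_3) : a != b -> polar a b p = 0 ->
  flow (polar_field K a b) p = p%:P.
Proof.
move=> ab pab; apply: flow_invariant_of_vfield => // v.
case/mxvec_indexP: v => r i; rewrite /polar_field entriesE.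
case: eqP => _; last by rewrite -mpolyC0 flowC.
by rewrite /dvar flowX entriesE eq_sym (negPf ab) mul0r addr0.
Qed.

Section Points.
Variables (L : fieldType) (h : {rmorphism K -> L}).
Implicit Type M : 'I_3 -> 'I_3 -> L.

Definition col_op (a b : 'I_3) (s : L) M : 'I_3 -> 'I_3 -> L :=
  fun r i => if i == a then M r i + M r b * s else M r i.

Definition row_op_y (s : L) M : 'I_3 -> 'I_3 -> L := fun r i =>
  if r == 1 then M 1 i + M 0 i * s
  else if r == 2%:R then M 2%:R i + 3%:R * M 1 i * s else M r i.

Definition row_op_z (s : L) M : 'I_3 -> 'I_3 -> L := fun r i =>
  if r == 2%:R then M 2%:R i + M 0 i * s else M r i.

Lemma jet_eval_polar_col (a b : 'I_3) s M : a != b -> polar a b p = 0 ->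
  jet_eval h (col_op a b s M) p = jet_eval h M p.
Proof.
move=> ab pab; rewrite -(jet_eval_flow h M s (polar_flow ab pab)).
apply: jet_eval_ext => r i; rewrite /col_op.
by case: eqP => _; rewrite ?jet_eval_dvar // rmorph0 mul0r addr0.
Qed.

(** The elementary column operation from column 0 to column 2 is the group
    commutator of those from 0 to 1 and from 1 to 2. *)
Lemma jet_eval_col20 s M : jet_eval h (col_op 2%:R 0 s M) p = jet_eval h M p.
Proof.
pose M' := col_op 2%:R 1 (-1) (col_op 1 0 (- s) (col_op 2%:R 1 1 (col_op 1 0 s M))).
transitivity (jet_eval h M' p); last by rewrite /M' !jet_eval_polar_col.
apply: jet_eval_ext => r i; rewrite /M' /col_op.
by elim/ord3P: i; rewrite /=; ring.
Qed.

Lemma jet_eval_row_y s M : jet_eval h (row_op_y s M) p = jet_eval h M p.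
Proof.
have [inv _] := unipotent_invariant_shear p_inv.
rewrite -(jet_eval_flow h M s inv); apply: jet_eval_ext => r i.
rewrite /row_op_y /shear_y; elim/ord3P: r => /=.
- by rewrite rmorph0 mul0r addr0.
- by rewrite jet_eval_dvar.
- by rewrite rmorphM rmorph_nat /= jet_eval_dvar.
Qed.

Lemma jet_eval_row_z s M : jet_eval h (row_op_z s M) p = jet_eval h M p.
Proof.
have [_ inv] := unipotent_invariant_shear p_inv.
rewrite -(jet_eval_flow h M s inv); apply: jet_eval_ext => r i.
rewrite /row_op_z /shear_z; elim/ord3P: r => /=.
- by rewrite rmorph0 mul0r addr0.
- by rewrite rmorph0 mul0r addr0.
- by rewrite jet_eval_dvar.
Qed.

Definition mat3 (x1 x2 x3 y1 y2 y3 z1 z2 z3 : L) : 'I_3 -> 'I_3 -> L := fun r i =>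
  if r == 0 then if i == 0 then x1 else if i == 1 then x2 else x3
  else if r == 1 then if i == 0 then y1 else if i == 1 then y2 else y3
  else if i == 0 then z1 else if i == 1 then z2 else z3.

Definition normal_form (a b c d : L) := mat3 a 0 0 0 (b / a) 0 0 (c / a ^+ 2) (d / b).

(** Gaussian elimination restricted to the permitted operations: clear the first
    row with its pivot a, then the first column with the row operations, then
    f_3'' with the pivot b/a.  The entries that remain are determined by the
    values of the four invariants. *)
Lemma jet_eval_normal_form M (a := M 0 0) (b := jet_eval h M (w2 K 0 1)) :
  a != 0 -> b != 0 ->
  jet_eval h M p = jet_eval h (normal_form a b (jet_eval h M (w3 K 0 0 1))
                                 (jet_eval h M (wronskian K))) p.
Proof.
move=> a0; rewrite {}/b jet_eval_w2 jet_eval_w3 jet_eval_wronskian -/a => b0.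
have a0' : M 0 0 != 0 := a0.
(* M1 and M2 clear f_2' and f_3', M3 and M4 clear f_1'' and f_1''', M5 clears
   f_3''. *)
pose M1 := col_op 1 0 (- (M 0 1 / a)) M.
pose M2 := col_op 2%:R 0 (- (M 0 2%:R / a)) M1.
pose M3 := row_op_y (- (M 1 0 / a)) M2.
pose M4 := row_op_z (- (M3 2%:R 0 / a)) M3.
pose M5 := col_op 2%:R 1 (- (M4 1 2%:R / M4 1 1)) M4.
transitivity (jet_eval h M5 p).
  by rewrite /M5 jet_eval_polar_col // /M4 jet_eval_row_z /M3 jet_eval_row_y
    /M2 jet_eval_col20 /M1 jet_eval_polar_col.
have E11 : M4 1 1 = (a * M 1 1 - M 1 0 * M 0 1) / a.
  by rewrite /M4 /row_op_z /M3 /row_op_y /M2 /col_op /M1 /col_op /= /a; field.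
apply: jet_eval_ext => r i; rewrite /M5 /col_op E11.
rewrite /M4 /row_op_z /M3 /row_op_y /M2 /col_op /M1 /col_op /normal_form /mat3.
by elim/ord3P: r; elim/ord3P: i; rewrite /= ?E11 /a; field; rewrite ?a0 ?b0.
Qed.

End Points.
End HighestWeight.

(** * Highest weight vectors *)

Section DoubleInvariants.
Variable K : numFieldType.
Local Notation ring := (jet_ring K 3 3).

Definition quad (S : Type) (a b c d : S) (i : 'I_4) : S := tnth [tuple a; b; c; d] i.

Definition hw_generator : 'I_4 -> ring :=
  quad (d1 K 0) (w2 K 0 1) (w3 K 0 0 1) (wronskian K).

Definition hw_eval : {mpoly K[4]} -> ring := mmap (@mpolyC (3 * 3) K) hw_generator.

(** Every entry of the normal form times a^2 b is a polynomial in a, b, c, d. *)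
Lemma normal_form_denominator (q : ring) : exists (N : nat) (F : {mpoly K[4]}),
  forall (L : fieldType) (h : {rmorphism K -> L}) (a b c d : L), a != 0 -> b != 0 ->
    (a ^+ 2 * b) ^+ N * jet_eval h (normal_form a b c d) q = mmap h (quad a b c d) F.
Proof.
elim/mpoly_ring_ind: q => [c|v|p q [N [F EF]] [M [G EG]]|p q [N [F EF]] [M [G EG]]].
- by exists 0%N, c%:MP => L h a b x d _ _; rewrite mul1r jet_evalC mmapC.
- case/mxvec_indexP: v => r i; rewrite -/(dvar K r i).
  suff [F EF] : exists F : {mpoly K[4]}, forall (L : fieldType) (h : {rmorphism K -> L})
      (a b c d : L), a != 0 -> b != 0 ->
      a ^+ 2 * b * normal_form a b c d r i = mmap h (quad a b c d) F.
    by exists 1%N, F => L h a b c d a0 b0; rewrite expr1 jet_eval_dvar; apply: EF.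
  have X (j : 'I_4) (L : fieldType) (h : {rmorphism K -> L}) f : mmap h f 'X_j = f j.
    by rewrite mmapX mmap1U.
  have z : exists F : {mpoly K[4]}, forall (L : fieldType) (h : {rmorphism K -> L})
      (a b c d : L), a != 0 -> b != 0 ->
      a ^+ 2 * b * 0 = mmap h (quad a b c d) F.
    by exists 0 => L h a b c d _ _; rewrite mulr0 rmorph0.
  elim/ord3P: r; elim/ord3P: i => //=.
  + exists ('X_0 ^+ 3 * 'X_1) => L h a b c d a0 b0.
    by rewrite rmorphM rmorphXn /= !X /quad /tnth /normal_form /mat3 /=; ring.
  + exists ('X_0 * 'X_1 ^+ 2) => L h a b c d a0 b0.
    by rewrite rmorphM rmorphXn /= !X /quad /tnth /normal_form /mat3 /=; field.
  + exists ('X_1 * 'X_2%:R) => L h a b c d a0 b0.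
    by rewrite rmorphM /= !X /quad /tnth /normal_form /mat3 /=; field.
  + exists ('X_0 ^+ 2 * 'X_3%:R) => L h a b c d a0 b0.
    by rewrite rmorphM rmorphXn /= !X /quad /tnth /normal_form /mat3 /=; field.
- exists (N + M)%N, (('X_0 ^+ 2 * 'X_1) ^+ M * F + ('X_0 ^+ 2 * 'X_1) ^+ N * G).
  move=> L h a b c d a0 b0; rewrite rmorphD [in RHS]rmorphD !rmorphM /= !rmorphXn /= rmorphM rmorphXn /=.
  by rewrite -EF // -EG // !mmapX !mmap1U /quad /tnth /= exprD; ring.
- exists (N + M)%N, (F * G) => L h a b c d a0 b0.
  by rewrite !rmorphM /= -EF // -EG // exprD; ring.
Qed.

Local Notation frac4 := {fraction {mpoly K[4]}}.
Local Notation embed4 := (frac_const K 4).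

(** Let M be a point with the i-th invariant equal to 0 and independent values
    for the others.  Evaluating there shows that F vanishes when its i-th
    variable is 0, so F is a multiple of that variable. *)
Lemma hw_eval_divide (i : 'I_4) (M : 'I_3 -> 'I_3 -> frac4) (q : ring) F :
  hw_generator i != 0 ->
  (forall j, jet_eval embed4 M (hw_generator j)
             = if j == i then 0 else FracField.tofrac ('X_j)) ->
  hw_generator i * q = hw_eval F -> exists F', q = hw_eval F'.
Proof.
move=> gi0 gM Eq; have [F' EF] := mpoly_split_var i F.
exists F'; apply: (mulfI gi0); rewrite Eq [in LHS]EF.
suff -> : mmap (@mpolyC 4 K) (fun j => if j == i then 0 else 'X_j) F = 0.
  by rewrite addr0 /hw_eval rmorphM /= mmapX mmap1U.
apply: tofracK; rewrite rmorph0 (mmap_comp (h := embed4)) //.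
have : jet_eval embed4 M (hw_generator i) * jet_eval embed4 M q
    = jet_eval embed4 M (hw_eval F) by rewrite -rmorphM Eq.
rewrite gM eqxx mul0r /hw_eval (mmap_comp (h := embed4)) => [E|c]; last first.
  exact: jet_evalC.
rewrite [RHS]E; apply: eq_mmap => j; rewrite [RHS](gM j).
by case: eqP => _; rewrite ?rmorph0.
Qed.

(** With f_1' = f_3' = 0 the invariants become w_12 = - f_1'' f_2' and
    w_12^1 = 3 (f_1'')^2 f_2', which are solved for f_1'' and f_2'; then f_3'''
    is chosen to give W. *)
Lemma hw_generator_at_d1_eq0 (L : fieldType) (h : {rmorphism K -> L}) (b c d : L) :
  b != 0 -> c != 0 -> forall j,
  jet_eval h (mat3 0 (3%:R * b ^+ 2 / c) 0 (- c / (3%:R * b)) 0 0 0 0 (d / b))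
    (hw_generator j) = quad 0 b c d j.
Proof.
move=> b0 c0; have three : (3%:R : L) != 0.
  by rewrite -(rmorph_nat h) fmorph_eq0 pnatr_eq0.
elim/ord4P; rewrite /hw_generator /quad /tnth /=.
- by rewrite jet_eval_dvar.
- by rewrite jet_eval_w2 /mat3 /=; field; rewrite b0 c0 three.
- by rewrite jet_eval_w3 /mat3 /=; field; rewrite b0 c0 three.
- by rewrite jet_eval_wronskian /mat3 /=; field; rewrite b0 c0 three.
Qed.

(** With f' = (a, 0, 0) and f_1'' = f_2'' = 0 the invariants are
    w_12^1 = a^2 f_2''' and W = - a f_3'' f_2'''. *)
Lemma hw_generator_at_w2_eq0 (L : fieldType) (h : {rmorphism K -> L}) (a c d : L) :
  a != 0 -> c != 0 -> forall j,
  jet_eval h (mat3 a 0 0 0 0 (- (d * a / c)) 0 (c / a ^+ 2) 0) (hw_generator j)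
    = quad a 0 c d j.
Proof.
move=> a0 c0; elim/ord4P; rewrite /hw_generator /quad /tnth /=.
- by rewrite jet_eval_dvar.
- by rewrite jet_eval_w2 /mat3 /=; ring.
- by rewrite jet_eval_w3 /mat3 /=; field; rewrite a0.
- by rewrite jet_eval_wronskian /mat3 /=; field; rewrite a0 c0.
Qed.

Lemma tofracX_neq0 (j : 'I_4) : FracField.tofrac ('X_j : {mpoly K[4]}) != 0.
Proof. by rewrite tofrac_eq0 mpolyX_neq0. Qed.

Lemma hw_eval_divide_d1 q F : d1 K 0 * q = hw_eval F -> exists F', q = hw_eval F'.
Proof.
have at0 := hw_generator_at_d1_eq0 embed4 (FracField.tofrac 'X_3%:R)
  (tofracX_neq0 1) (tofracX_neq0 2%:R).
apply: (hw_eval_divide (i := 0)) => [|j].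
  by rewrite /hw_generator /quad /= /d1 /dvar mpolyX_neq0.
by apply: etrans (at0 j) _; elim/ord4P: j.
Qed.

Lemma w2_neq0 : w2 K 0 1 != 0.
Proof.
apply/eqP => /(congr1 (jet_eval idfun (mat3 1 0 0 0 1 0 0 0 0))).
rewrite jet_eval_w2 /mat3 /= rmorph0 mulr1 mulr0 subr0 => /eqP.
by rewrite oner_eq0.
Qed.

Lemma hw_eval_divide_w2 q F : w2 K 0 1 * q = hw_eval F -> exists F', q = hw_eval F'.
Proof.
have at0 := hw_generator_at_w2_eq0 embed4 (FracField.tofrac 'X_3%:R)
  (tofracX_neq0 0) (tofracX_neq0 2%:R).
apply: (hw_eval_divide (i := 1)) => [|j]; first exact: w2_neq0.
by apply: etrans (at0 j) _; elim/ord4P: j.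
Qed.

Lemma hw_eval_subalg F : subalg_gen (@jet_generator K) (hw_eval F).
Proof.
elim/mpoly_ring_ind: F => [c|i|p q Bp Bq|p q Bp Bq].
- rewrite /hw_eval mmapC /=.
  have -> : c%:MP = c%:A :> ring by rewrite -mul_mpolyC mulr1.
  exact: SubalgScalar.
- rewrite /hw_eval mmapX mmap1U; elim/ord4P: i; apply: SubalgGen.
  + exact: GenD1.
  + exact: GenW2.
  + exact: GenW3.
  + exact: GenWronskian.
- by rewrite /hw_eval rmorphD; apply: SubalgAdd.
- by rewrite /hw_eval rmorphM; apply: SubalgMul.
Qed.

(** The generic point over the fraction field of the jet ring turns the normal
    form into the identity (a^2 b)^N p = F(a, b, c, d) in the jet ring itself. *)
Lemma highest_weight_subalg (p : ring) : unipotent_invariant p ->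
  polar 1 0 p = 0 -> polar 2%:R 1 p = 0 -> subalg_gen (@jet_generator K) p.
Proof.
move=> p_inv p10 p21.
suff [F ->] : exists F, p = hw_eval F by exact: hw_eval_subalg.
have [N [F EF]] := normal_form_denominator p.
pose iota := jet_frac_embed K 3 3.
pose gen (r i : 'I_3) : {fraction ring} := FracField.tofrac (dvar K r i).
have genE q : jet_eval iota gen q = FracField.tofrac q.
  apply: mmap_unique => [c|v]; first exact: jet_evalC.
  by case/mxvec_indexP: v => r i; apply: jet_eval_dvar.
have d10 : d1 K 0 != 0 by rewrite /d1 /dvar mpolyX_neq0.
have E : (d1 K 0 ^+ 2 * w2 K 0 1) ^+ N * p = hw_eval F.
  apply: tofracK; rewrite [RHS](mmap_comp (h := iota)) //.
  have w0 : w2 K 0 1 != 0 by exact: w2_neq0.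
  rewrite tofracM tofracXn tofracM tofracXn -(genE p).
  rewrite (jet_eval_normal_form p_inv p10 p21) ?genE ?tofrac_eq0 //.
  rewrite EF ?tofrac_eq0 //; apply: eq_mmap.
  by elim/ord4P.
elim: N F E {EF} => [|N IH] F; first by rewrite mul1r; exists F.
rewrite exprS -[_ * _ * p]mulrA; set q := _ ^+ N * p; rewrite expr2 -!mulrA.
move=> /hw_eval_divide_d1[F1] /hw_eval_divide_d1[F2] /hw_eval_divide_w2[F3].
exact: IH.
Qed.

End DoubleInvariants.

(** * Generation of the algebra of invariants *)

Section Generation.
Variable K : numClosedFieldType.
Local Notation ring := (jet_ring K 3 3).
Local Notation B := (subalg_gen (@jet_generator K)).

Lemma unipotent_invariantB (p q : ring) :
  unipotent_invariant p -> unipotent_invariant q -> unipotent_invariant (p - q).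
Proof.
move=> ip iq phi uphi.
by rewrite reparamE rmorphB /= -!reparamE ip ?iq.
Qed.

(** Induction on the weight: a raised vector satisfies the same hypotheses,
    since lowering operators preserve B, and has smaller weight, so it is 0 and
    c is a highest weight vector. *)
Lemma orthogonal_unipotent_eq0 (N : nat) (c : ring) :
  unipotent_invariant c -> (msize c <= N)%N ->
  (forall q, B q -> (msize q <= N)%N -> fischer c q = 0) -> c = 0.
Proof.
have [w] := ubnP (mmeasure column_weight c).
elim: w c => [//|w IH] c cw ic sc oc.
have raise0 (a b : 'I_3) : (b < a)%N -> polar a b c = 0.
  move=> ba; apply/eqP/negP => /negP nz; move/negP: (nz); apply; apply/eqP.
  apply: IH.
  - exact: leq_trans (mmeasure_polar_lt ba nz) cw.
  - exact: polar_unipotent_invariant.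
  - exact: leq_trans (msize_polar _ _ _) sc.
  - move=> q Bq sq; rewrite fischer_polar; apply: oc.
      by apply: polar_subalg; rewrite // -val_eqE neq_ltn ba.
    exact: leq_trans (msize_polar _ _ _) sq.
apply: fischer_eq0; apply: oc => //.
by apply: highest_weight_subalg => //; apply: raise0.
Qed.

(** The remainder of p after projection to B in degree at most the degree of p
    is an invariant orthogonal to B. *)
Lemma unipotent_invariant_subalg (p : ring) : unipotent_invariant p -> B p.
Proof.
move=> ip; pose N := msize p.
pose PB (q : ring) := B q /\ (msize q <= N)%N.
pose s := [seq bmnm m | m <- enum {: bmultinom (3 * 3) N}].
have [|||b [Bb sb] bO] := @orthogonal_projection K (3 * 3) PB s _ _ _ p.
- by split; [apply: subalg_gen0 | rewrite mmeasure0].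
- move=> a q r [Bq sq] [Br sr]; split.
    by apply: SubalgAdd => //; apply: subalg_genZ.
  rewrite (leq_trans (mmeasureD_le _ _ _)) // geq_max sr andbT.
  exact: leq_trans (mmeasureZ_le _ _ _) sq.
- move=> q [_ sq] m /(@mmeasure_mnm_lt _ _ mdeg) mq; apply/mapP.
  by exists (BMultinom (leq_trans mq sq)); rewrite ?mem_enum.
suff /eqP : p - b = 0 by rewrite subr_eq0 => /eqP ->.
apply: (@orthogonal_unipotent_eq0 N).
- apply: unipotent_invariantB => //; apply: jet_diff_algebra_unipotent.
  exact: subalg_gen_jet_diff_algebra.
- rewrite (leq_trans (mmeasureD_le _ _ _)) // mmeasureN geq_max leqnn.
  exact: sb.
- by move=> q Bq sq; apply: bO; split.
Qed.

End Generation.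

(** * Transcendence degree *)

Section TranscendenceDegree.
Variable K : numFieldType.
Local Notation ring := (jet_ring K 3 3).
Local Notation iota := (jet_frac_embed K 3 3).
Local Notation tofrac := (@FracField.tofrac ring).

Definition slice_generator : 7.-tuple ring :=
  [tuple d1 K 0; d1 K 1; d1 K 2%:R; w2 K 0 1; w2 K 0 2%:R; w3 K 0 0 1; w3 K 0 0 2%:R].

Definition trans_basis : 7.-tuple {fraction ring} := map_tuple tofrac slice_generator.

Local Notation F := (subfield_gen iota (fun z => z \in trans_basis)).

Lemma slice_generator_jet i : jet_generator (tnth slice_generator i).
Proof.
case: i => [[|[|[|[|[|[|[|//]]]]]]] lti]; rewrite (tnth_nth 0) /=.
- exact: GenD1.
- exact: GenD1.
- exact: GenD1.
- exact: GenW2.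
- exact: GenW2.
- exact: GenW3.
- exact: GenW3.
Qed.

(** The seven elements take arbitrary prescribed values x_i, with x_0 nonzero,
    on the slice f_1'' = f_1''' = 0. *)
Lemma slice_generator_eval (L : fieldType) (h : {rmorphism K -> L}) (x : nat -> L) :
  x 0%N != 0 -> forall i : 'I_7,
  jet_eval h (mat3 (x 0%N) (x 1%N) (x 2%N) 0 (x 3%N / x 0%N) (x 4%N / x 0%N)
                   0 (x 5%N / x 0%N ^+ 2) (x 6%N / x 0%N ^+ 2))
    (tnth slice_generator i) = x i.
Proof.
move=> x0 [[|[|[|[|[|[|[|//]]]]]]] lti]; rewrite (tnth_nth 0) /=.
- by rewrite jet_eval_dvar.
- by rewrite jet_eval_dvar.
- by rewrite jet_eval_dvar.
- by rewrite jet_eval_w2 /mat3 /=; field.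
- by rewrite jet_eval_w2 /mat3 /=; field.
- by rewrite jet_eval_w3 /mat3 /=; field.
- by rewrite jet_eval_w3 /mat3 /=; field.
Qed.

Local Notation tofrac7 := (@FracField.tofrac {mpoly K[7]}).
Local Notation embed7 := (frac_const K 7).

(** Evaluate a relation at a point of the slice where the seven elements are
    independent variables. *)
Lemma trans_basis_independent : alg_independent iota trans_basis.
Proof.
move=> P P0; pose x k : {fraction {mpoly K[7]}} := tofrac7 'X_(@inord 6 k).
have x0 : x 0%N != 0 by rewrite tofrac_eq0 mpolyX_neq0.
have gP0 : mmap (@mpolyC (3 * 3) K) (tnth slice_generator) P = 0.
  apply: tofracK; rewrite tofrac0 -[RHS]P0 [LHS](mmap_comp (h := iota)) //.
  by apply: eq_mmap => i; rewrite tnth_map.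
have xE := slice_generator_eval embed7 x0.
set M := mat3 _ _ _ _ _ _ _ _ _ in xE.
have := mmap_comp (tnth slice_generator) P (jet_evalC embed7 M).
rewrite gP0 rmorph0 => /esym MP; apply: tofracK; rewrite tofrac0 -[RHS]MP.
rewrite -{1}[P]comp_mpoly_id [LHS](mmap_comp (h := embed7)) //.
apply: eq_mmap => i; rewrite tnth_mktuple [RHS]xE.
by rewrite /x inord_val.
Qed.

Lemma slice_field_tnth i : F (tofrac (tnth slice_generator i)).
Proof. by apply: SubfieldGen; rewrite -tnth_map; apply: mem_tnth. Qed.

Lemma slice_field_nth i : (i < 7)%N -> F (tofrac (nth 0 slice_generator i)).
Proof. by move=> i7; have := slice_field_tnth (Ordinal i7); rewrite (tnth_nth 0). Qed.

Lemma slice_field_d1 (i : 'I_3) : F (tofrac (d1 K i)).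
Proof.
elim/ord3P: i.
- exact: (@slice_field_nth 0).
- exact: (@slice_field_nth 1).
- exact: (@slice_field_nth 2).
Qed.

Lemma slice_field0 : F 0.
Proof. by rewrite -(rmorph0 iota); apply: SubfieldScalar. Qed.

Lemma slice_fieldM (p q : ring) : F (tofrac p) -> F (tofrac q) -> F (tofrac (p * q)).
Proof. by rewrite tofracM; apply: SubfieldMul. Qed.

Lemma slice_fieldZ c (p : ring) : F (tofrac p) -> F (tofrac (c *: p)).
Proof.
rewrite -mul_mpolyC => Fp; apply: slice_fieldM => //.
exact: (SubfieldScalar iota _ c).
Qed.

Lemma slice_fieldB (p q : ring) : F (tofrac p) -> F (tofrac q) -> F (tofrac (p - q)).
Proof.
rewrite -scaleN1r tofracD => Fp Fq; apply: SubfieldAdd => //.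
exact: slice_fieldZ.
Qed.

Lemma slice_field_div (q : ring) : F (tofrac (d1 K 0 * q)) -> F (tofrac q).
Proof.
have x0 : tofrac (d1 K 0) != 0 by rewrite tofrac_eq0 mpolyX_neq0.
move=> Fq; rewrite -[tofrac q](mulKf x0) -tofracM.
by apply: SubfieldMul => //; apply: SubfieldInv; apply: slice_field_d1.
Qed.

(** The Plucker-type relation f_1' w_ij = f_i' w_1j - f_j' w_1i. *)
Lemma slice_field_w2 (i j : 'I_3) : F (tofrac (w2 K i j)).
Proof.
have F0 k : F (tofrac (w2 K 0 k)).
  elim/ord3P: k; last 2 first.
  - exact: (@slice_field_nth 3).
  - exact: (@slice_field_nth 4).
  have -> : w2 K 0 0 = 0 by rewrite /w2; ring.
  by rewrite tofrac0; apply: slice_field0.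
apply: slice_field_div.
have -> : d1 K 0 * w2 K i j = d1 K i * w2 K 0 j - d1 K j * w2 K 0 i by rewrite /w2; ring.
by apply: slice_fieldB; apply: slice_fieldM => //; apply: slice_field_d1.
Qed.

(** First i = 1 and k arbitrary, by f_1' w_1l^k = f_k' w_1l^1 - 3 w_1l w_1k;
    then i arbitrary, by f_1' w_ij^k = f_i' w_1j^k - f_j' w_1i^k. *)
Lemma slice_field_w3 (k i j : 'I_3) : F (tofrac (w3 K k i j)).
Proof.
have F00 l : F (tofrac (w3 K 0 0 l)).
  elim/ord3P: l; last 2 first.
  - exact: (@slice_field_nth 5).
  - exact: (@slice_field_nth 6).
  have -> : w3 K 0 0 0 = 0 by rewrite /w3; ring.
  by rewrite tofrac0; apply: slice_field0.
have F0 l : F (tofrac (w3 K k 0 l)).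
  apply: slice_field_div.
  have -> : d1 K 0 * w3 K k 0 l
      = d1 K k * w3 K 0 0 l - (3%:R : K) *: (w2 K 0 l * w2 K 0 k).
    by rewrite scaler_nat -[_ *+ 3]mulr_natl /w2 /w3; ring.
  apply: slice_fieldB; first by apply: slice_fieldM => //; apply: slice_field_d1.
  by apply: slice_fieldZ; apply: slice_fieldM; apply: slice_field_w2.
apply: slice_field_div.
have -> : d1 K 0 * w3 K k i j = d1 K i * w3 K k 0 j - d1 K j * w3 K k 0 i.
  by rewrite /w3; ring.
by apply: slice_fieldB; apply: slice_fieldM => //; apply: slice_field_d1.
Qed.

Lemma slice_field_generator (g : ring) : jet_generator g -> F (tofrac g).
Proof.
case=> [l|i j _|k i j _|].
- exact: slice_field_d1.
- exact: slice_field_w2.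
- exact: slice_field_w3.
- do 2 apply: slice_field_div.
  have -> : d1 K 0 * (d1 K 0 * wronskian K)
      = w2 K 0 1 * w3 K 0 0 2%:R - w2 K 0 2%:R * w3 K 0 0 1.
    by rewrite wronskianE /w2 /w3; ring.
  by apply: slice_fieldB; apply: slice_fieldM;
    do [apply: slice_field_w2 | apply: slice_field_w3].
Qed.

Lemma algebraic_over_mem (y : {fraction ring}) : F y -> algebraic_over F y.
Proof.
move=> Fy; exists ('X - y%:P); split; last by rewrite root_XsubC.
  by rewrite polyXsubC_eq0.
have F1 : F 1 by rewrite -(rmorph1 iota); apply: SubfieldScalar.
have FN : F (- y).
  rewrite -mulN1r -(rmorphN1 iota); apply: SubfieldMul => //.
  exact: SubfieldScalar.
move=> [|[|i]]; rewrite coefB coefX coefC /= ?subr0 ?sub0r //.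
exact: slice_field0.
Qed.

Lemma jet_generator_trdeg :
  has_trdeg iota (subfield_gen iota (@jet_generator_frac K)) 7.
Proof.
exists trans_basis; split.
- move=> y /tnthP[i ->]; rewrite tnth_map; apply: SubfieldGen.
  by exists (tnth slice_generator i) => //; apply: slice_generator_jet.
- exact: trans_basis_independent.
- move=> y Fy; apply: algebraic_over_mem.
  elim: Fy => [c|z [g gP ->]|z t _ Fz _ Ft|z t _ Fz _ Ft|z _ Fz].
  + exact: SubfieldScalar.
  + exact: slice_field_generator.
  + exact: SubfieldAdd.
  + exact: SubfieldMul.
  + exact: SubfieldInv.
Qed.

End TranscendenceDegree.

Theorem mainTheorem1 (R : realType) :
  [/\ forall Q : jet_ring R[i] 3 3,
        jet_diff_algebra Q <-> unipotent_invariant Q,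
      forall Q : jet_ring R[i] 3 3,
        unipotent_invariant Q <-> subalg_gen (@jet_generator R[i]) Q
    & has_trdeg (jet_frac_embed R[i] 3 3)
        (subfield_gen (jet_frac_embed R[i] 3 3) (@jet_generator_frac R[i])) 7].
Proof.
split=> [Q|Q|].
- split=> [|invQ]; first exact: jet_diff_algebra_unipotent.
  exact: subalg_gen_jet_diff_algebra (unipotent_invariant_subalg invQ).
- split=> [|BQ]; first exact: unipotent_invariant_subalg.
  exact: jet_diff_algebra_unipotent (subalg_gen_jet_diff_algebra BQ).
- exact: jet_generator_trdeg.
Qed.
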